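(* Let $\mathcal H_1,\mathcal H_2$ be finite-dimensional complex Hilbert spaces, let $\rho_1,\dots,\rho_n$ be density operators on $\mathcal H_1$, and let $|\phi_1\rangle,\dots,|\phi_n\rangle\in\mathcal H_2$ be unit vectors. For each $i$ fix a spectral decomposition $\rho_i=\sum_{k=1}^{t_i}|\tilde\varphi^{(i)}_k\rangle\langle\tilde\varphi^{(i)}_k|$ into nonzero, mutually orthogonal (non-normalized) vectors. For each $i$ let $\Gamma_i=\mathrm{diag}\{\eta^{(i)}_1,\dots,\eta^{(i)}_{t_i}\}$ with $\eta^{(i)}_k\ge 0$, and let $\Gamma=\mathrm{diag}\{\Gamma_1,\dots,\Gamma_n\}$. Let $\tilde X$ and $Y$ be the square block matrices of size $\sum_i t_i$ whose $(i,j)$ blocks are the $t_i\times t_j$ matrices with entries $(\tilde X_{ij})_{kl}=\langle\tilde\varphi^{(i)}_k|\tilde\varphi^{(j)}_l\rangle$ and $(Y_{ij})_{kl}=\langle\phi_i|\phi_j\rangle$. Then the states $\rho_1,\dots,\rho_n$ can be transformed respectively to the pure states $|\phi_1\rangle,\dots,|\phi_n\rangle$ with success probability matrix $\Gamma$ if and only if there exists a positive semidefinite matrix $A$ of size $\sum_i t_i$ (with blocks $A_{ij}$ of size $t_i\times t_j$) with all diagonal entries $(A_{ii})_{kk}=1$ such that $$\tilde X-\sqrt{\Gamma}\,Y\sqrt{\Gamma}^{\dagger}\circ A\ \ge\ 0 .$$ Moreover, if the input states are chosen with prior probabilities $p_1,\dots,p_n\ge 0$, $\sum_i p_i=1$,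 then the whole success probability of such a transformation is $P=\sum_i p_i\,\mathrm{Tr}(\Gamma_i)$.
   Context: A physically accessible operation from $\mathcal H_1$ to $\mathcal H_2$ is a completely positive trace non-increasing map $\xi$ from operators on $\mathcal H_1$ to operators on $\mathcal H_2$, i.e. $\xi(\rho)=\sum_m M_m\rho M_m^\dagger$ with $\sum_m M_m^\dagger M_m\le I$. The states $\rho_i$ ''can be transformed to $|\phi_i\rangle$ with success probability matrix $\Gamma$'' means that there is a single such map $\xi$ with $\xi(|\tilde\varphi^{(i)}_k\rangle\langle\tilde\varphi^{(i)}_k|)=\eta^{(i)}_k|\phi_i\rangle\langle\phi_i|$ for all $i$ and all $k=1,\dots,t_i$; in particular $\xi(\rho_i)=\mathrm{Tr}(\Gamma_i)\,|\phi_i\rangle\langle\phi_i|$. The success probability on an input state $\rho$ is $\mathrm{Tr}\,\xi(\rho)$, and the whole success probability for input states $\rho_i$ with priors $p_i$ is $P=\sum_i p_i\,\mathrm{Tr}\,\xi(\rho_i)$. $\sqrt\Gamma$ is the entrywise (nonnegative) square root of the diagonal matrix $\Gamma$, $\circ$ denotes the Hadamard (entrywise) matrix product, so that the matrix $\sqrt{\Gamma}\,Y\sqrt{\Gamma}^{\dagger}\circ A$ has entries $\sqrt{\eta^{(i)}_k\eta^{(j)}_l}\,\langle\phi_i|\phi_j\rangle\,(A_{ij})_{kl}$, and $M\ge 0$ means $M$ is Hermitian positive semidefinite. *)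

(* Defs.v *)
From HB Require Import structures.
From mathcomp Require Import all_boot all_order all_algebra.
From mathcomp Require Import complex reals.

Set Implicit Arguments.
Unset Strict Implicit.
Unset Printing Implicit Defensive.

Import Order.TTheory GRing.Theory Num.Theory.
Local Open Scope ring_scope.
Local Open Scope sesquilinear_scope.
Local Open Scope complex_scope.

(* A d-dimensional complex Hilbert space is taken in
   coordinates: kets are column vectors 'cV[R[i]]_d with the standard inner
   product, and operators from dimension d1 to dimension d2 are matrices
   'M[R[i]]_(d2, d1).  "M ^t*" is the conjugate transpose. *)

(* <u|v>, conjugate-linear in the first argument. *)
Definition braket (R : realType) (d : nat) (u v : 'cV[R[i]]_d) : R[i] :=
  (u ^t* *m v) 0 0.

(* |u><v| *)
Definition ketbra (R : realType) (d : nat) (u v : 'cV[R[i]]_d) : 'M[R[i]]_d :=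
  u *m v ^t*.

(* In the order of R[i], "0 <= z" entails that z is real. *)
Definition psdmx (R : realType) (d : nat) (M : 'M[R[i]]_d) : Prop :=
  M \is hermsymmx /\ forall v : 'cV[R[i]]_d, 0 <= (v ^t* *m M *m v) 0 0.

Definition density_operator (R : realType) (d : nat) (rho : 'M[R[i]]_d) : Prop :=
  psdmx rho /\ \tr rho = 1.

Definition unit_ket (R : realType) (d : nat) (u : 'cV[R[i]]_d) : Prop :=
  braket u u = 1.

(* The eigenvalues are absorbed in the squared norms of the vectors v k. *)
Definition spectral_decomposition (R : realType) (d t : nat)
    (rho : 'M[R[i]]_d) (v : 'I_t -> 'cV[R[i]]_d) : Prop :=
  [/\ rho = \sum_(k < t) ketbra (v k) (v k),
      forall k, v k != 0
    & forall k l, k != l -> braket (v k) (v l) = 0].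

(* Completely positive trace non-increasing maps, in Kraus form. *)
Definition physically_accessible (R : realType) (d1 d2 : nat)
    (xi : 'M[R[i]]_d1 -> 'M[R[i]]_d2) : Prop :=
  exists (r : nat) (K : 'I_r -> 'M[R[i]]_(d2, d1)),
    (forall rho, xi rho = \sum_(m < r) K m *m rho *m (K m) ^t*) /\
    psdmx (1%:M - \sum_(m < r) (K m) ^t* *m K m).

(* xi transforms the states sum_k |v i k><v i k| to the pure states phi i,
   with success probability matrix diag (eta i k). *)
Definition transforms (R : realType) (d1 d2 n : nat) (t : 'I_n -> nat)
    (v : forall i : 'I_n, 'I_(t i) -> 'cV[R[i]]_d1)
    (phi : 'I_n -> 'cV[R[i]]_d2) (eta : forall i : 'I_n, 'I_(t i) -> R)
    (xi : 'M[R[i]]_d1 -> 'M[R[i]]_d2) : Prop :=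
  physically_accessible xi /\
  forall (i : 'I_n) (k : 'I_(t i)),
    xi (ketbra (v i k) (v i k)) = (eta i k)%:C *: ketbra (phi i) (phi i).

Definition transformable (R : realType) (d1 d2 n : nat) (t : 'I_n -> nat)
    (v : forall i : 'I_n, 'I_(t i) -> 'cV[R[i]]_d1)
    (phi : 'I_n -> 'cV[R[i]]_d2) (eta : forall i : 'I_n, 'I_(t i) -> R) : Prop :=
  exists xi : 'M[R[i]]_d1 -> 'M[R[i]]_d2, transforms v phi eta xi.

Definition Gamma_block (R : realType) (n : nat) (t : 'I_n -> nat)
    (eta : forall i : 'I_n, 'I_(t i) -> R) (i : 'I_n) : 'M[R[i]]_(t i) :=
  diag_mx (\row_(k < t i) (eta i k)%:C).

Definition Gamma (R : realType) (n : nat) (t : 'I_n -> nat)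
    (eta : forall i : 'I_n, 'I_(t i) -> R) : 'M[R[i]]_(\sum_(i < n) t i) :=
  \mxdiag_(i < n) Gamma_block eta i.

Definition sqrt_mx (R : realType) (d1 d2 : nat) (M : 'M[R[i]]_(d1, d2)) :
    'M[R[i]]_(d1, d2) :=
  map_mx sqrtC M.

Definition Xtilde (R : realType) (d1 n : nat) (t : 'I_n -> nat)
    (v : forall i : 'I_n, 'I_(t i) -> 'cV[R[i]]_d1) :
    'M[R[i]]_(\sum_(i < n) t i) :=
  \mxblock_(i < n, j < n) \matrix_(k < t i, l < t j) braket (v i k) (v j l).

Definition Ymx (R : realType) (d2 n : nat) (t : 'I_n -> nat)
    (phi : 'I_n -> 'cV[R[i]]_d2) : 'M[R[i]]_(\sum_(i < n) t i) :=
  \mxblock_(i < n, j < n) (const_mx (braket (phi i) (phi j)) : 'M_(t i, t j)).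

Definition hadamard (R : realType) (d1 d2 : nat) (A B : 'M[R[i]]_(d1, d2)) :
    'M[R[i]]_(d1, d2) :=
  map2_mx *%R A B.

Definition success_probability (R : realType) (d1 d2 : nat)
    (xi : 'M[R[i]]_d1 -> 'M[R[i]]_d2) (rho : 'M[R[i]]_d1) : R[i] :=
  \tr (xi rho).

Definition whole_success_probability (R : realType) (d1 d2 n : nat)
    (p : 'I_n -> R) (rho : 'I_n -> 'M[R[i]]_d1)
    (xi : 'M[R[i]]_d1 -> 'M[R[i]]_d2) : R[i] :=
  \sum_(i < n) (p i)%:C * success_probability xi (rho i).

(* Main.v *)
Require Import Defs.
From HB Require Import structures.
From mathcomp Require Import all_boot all_order all_algebra.
From mathcomp Require Import complex reals ring.

Set Implicit Arguments.
Unset Strict Implicit.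
Unset Printing Implicit Defensive.

Import Order.TTheory GRing.Theory Num.Theory.
Local Open Scope ring_scope.
Local Open Scope sesquilinear_scope.
Local Open Scope complex_scope.

(* Index the vectors v^(i)_k by a single s, and let V be the matrix with
   columns v_s, so that X = V^* V.  If Kraus operators K_m send every
   |v_s><v_s| to e_s |phi_s><phi_s|, then each K_m v_s is a multiple c_ms phi_s
   with sum_m |c_ms|^2 = e_s, and compressing 1 - sum_m K_m^* K_m >= 0 by V gives
   the matrix inequality, with A the Gram matrix of the normalised coefficients
   c_ms / sqrt e_s.  Conversely, factor A = a^* a and let W_m have columns
   sqrt e_s a_ms phi_s; the inequality says sum_m W_m^* W_m <= V^* V, and
   Douglas' lemma provides a contraction (K_m) with K_m V = W_m. *)

(** * Conjugate transposes and Gram matrices *)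

Section Adjoint.
Variable C : numClosedFieldType.

Lemma adjmx_mul m n p (A : 'M[C]_(m, n)) (B : 'M[C]_(n, p)) :
  (A *m B) ^t* = B ^t* *m A ^t*.
Proof. by rewrite trmx_mul map_mxM. Qed.

Lemma adjmxD m n (A B : 'M[C]_(m, n)) : (A + B) ^t* = A ^t* + B ^t*.
Proof. by rewrite linearD map_mxD. Qed.

Lemma adjmxB m n (A B : 'M[C]_(m, n)) : (A - B) ^t* = A ^t* - B ^t*.
Proof. by rewrite linearB map_mxB. Qed.

Lemma adjmx1 n : (1%:M : 'M[C]_n) ^t* = 1%:M.
Proof. by rewrite trmx1 map_mx1. Qed.

Lemma gram_diag m n (M : 'M[C]_(m, n)) j :
  (M ^t* *m M) j j = \sum_i `|M i j| ^+ 2.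
Proof. by rewrite mxE; apply: eq_bigr => i _; rewrite !mxE mulrC normCK. Qed.

Lemma gram_diag_ge0 m n (M : 'M[C]_(m, n)) j : 0 <= (M ^t* *m M) j j.
Proof. by rewrite gram_diag sumr_ge0 // => i _; rewrite exprn_ge0. Qed.

Lemma gram_eq0 m n (M : 'M[C]_(m, n)) :
  (forall j, (M ^t* *m M) j j = 0) -> M = 0.
Proof.
move=> M0; apply/matrixP => i j; rewrite mxE; move: (M0 j).
rewrite gram_diag => /psumr_eq0P-/(_ (fun i _ => exprn_ge0 2 (normr_ge0 _))).
by move=> /(_ i isT)/eqP; rewrite expf_eq0 normr_eq0 => /eqP.
Qed.

End Adjoint.

(** * Positive semidefinite matrices, up to Douglas' lemma *)

Section Positive.
Variable R : realType.
Local Notation C := R[i].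

Lemma psdmxP n (M : 'M[C]_n) :
  psdmx M <-> M ^t* = M /\ forall v : 'cV[C]_n, 0 <= (v ^t* *m M *m v) 0 0.
Proof.
rewrite /psdmx is_hermitianmxE expr0 scale1r.
split=> -[MM M0]; split=> //; first by rewrite -(eqP MM).
by rewrite MM.
Qed.

Lemma psdmx_gram m n (M : 'M[C]_(m, n)) : psdmx (M ^t* *m M).
Proof.
apply/psdmxP; split=> [|v]; first by rewrite adjmx_mul trmxCK.
by rewrite mulmxA -adjmx_mul -mulmxA gram_diag_ge0.
Qed.

Lemma psdmx_congr m n (X : 'M[C]_m) (B : 'M[C]_(m, n)) :
  psdmx X -> psdmx (B ^t* *m X *m B).
Proof.
move=> /psdmxP[XX X0]; apply/psdmxP; split=> [|v].
  by rewrite !adjmx_mul trmxCK XX mulmxA.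
by have := X0 (B *m v); rewrite adjmx_mul !mulmxA.
Qed.

Lemma psdmxD n (X Y : 'M[C]_n) : psdmx X -> psdmx Y -> psdmx (X + Y).
Proof.
move=> /psdmxP[XX X0] /psdmxP[YY Y0]; apply/psdmxP; split=> [|v].
  by rewrite adjmxD XX YY.
by rewrite mulmxDr mulmxDl mxE addr_ge0.
Qed.

Lemma psdmx_diag_ge0 n (X : 'M[C]_n) j : psdmx X -> 0 <= X j j.
Proof.
move=> /psdmxP[_ /(_ (delta_mx j 0))].
by rewrite trmx_delta map_delta_mx -rowE -colE !mxE.
Qed.

(** The entries of [d] are nonnegative because they form the diagonal of [U *m X *m U ^t*], a
    congruence of [X]. *)
Lemma psdmx_spectral n (X : 'M[C]_n) : psdmx X ->
  exists (U : 'M[C]_n) (d : 'rV[C]_n),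
    [/\ U *m U ^t* = 1%:M, X = U ^t* *m diag_mx d *m U & forall j, 0 <= d 0 j].
Proof.
move=> X0; have /hermitian_normalmx/orthomx_spectralP := proj1 X0.
set U := spectralmx X; set d := spectral_diag X => XE.
have UU := spectral_unitarymx X.
have UU1 := unitarymxP UU; rewrite -/U in UU1.
rewrite invmx_unitary // in XE.
exists U, d; split=> // j.
have := psdmx_diag_ge0 j (psdmx_congr (U ^t*) X0).
by rewrite trmxCK XE !mulmxA UU1 mul1mx -mulmxA UU1 mulmx1 mxE eqxx.
Qed.

Lemma psdmx_factor n (X : 'M[C]_n) : psdmx X ->
  exists a : 'M[C]_n, X = a ^t* *m a.
Proof.
move=> /psdmx_spectral[U [d [_ -> d0]]].
exists (diag_mx (\row_j sqrtC (d 0 j)) *m U).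
rewrite adjmx_mul !mulmxA; congr (_ *m _); rewrite -mulmxA; congr (_ *m _).
rewrite tr_diag_mx map_diag_mx mulmx_diag; congr diag_mx.
apply/rowP=> j; rewrite !mxE /= geC0_conj ?sqrtC_ge0 //.
by rewrite -expr2 sqrtCK.
Qed.

(** The eigenvalues are inverted one by one in an eigenbasis; the convention [0^-1 = 0] makes this
    the Moore-Penrose inverse when [X] is singular. *)
Lemma psdmx_pinv n (X : 'M[C]_n) : psdmx X ->
  exists Z : 'M[C]_n, [/\ Z ^t* = Z, X *m Z *m X = X & Z *m X *m Z = Z].
Proof.
move=> /psdmx_spectral[U [d [UU -> d0]]].
have mulUdU (d1 d2 : 'rV[C]_n) :
    (U ^t* *m diag_mx d1 *m U) *m (U ^t* *m diag_mx d2 *m U) =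
    U ^t* *m diag_mx (\row_j (d1 0 j * d2 0 j)) *m U.
  by rewrite !mulmxA -(mulmxA _ U) UU mulmx1 -(mulmxA _ (diag_mx d1)) mulmx_diag.
exists (U ^t* *m diag_mx (\row_j (d 0 j)^-1) *m U); rewrite !mulUdU; split.
- rewrite !adjmx_mul trmxCK mulmxA; congr (_ *m _ *m _).
  rewrite tr_diag_mx map_diag_mx; congr diag_mx; apply/rowP=> j.
  by rewrite !mxE /= geC0_conj ?invr_ge0.
- congr (_ *m diag_mx _ *m _); apply/rowP=> j; rewrite !mxE.
  by have [->|d_neq0] := eqVneq (d 0 j) 0; rewrite ?mulr0 // divff ?mul1r.
- congr (_ *m diag_mx _ *m _); apply/rowP=> j; rewrite !mxE.
  by have [->|d_neq0] := eqVneq (d 0 j) 0; rewrite ?invr0 ?mulr0 // mulVf ?mul1r.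
Qed.

(* Douglas' factorisation lemma for a column of blocks: with Z the
   pseudo-inverse of X = V^* V, the operators K m = W m Z V^* satisfy
   K m V = W m because the W m vanish on the kernel of X, and
   sum_m (K m)^* (K m) is dominated by the orthogonal projection V Z V^*. *)
Lemma kraus_factor d1 d2 n r (V : 'M[C]_(d1, n)) (W : 'I_r -> 'M[C]_(d2, n)) :
  psdmx (V ^t* *m V - \sum_m (W m) ^t* *m W m) ->
  exists K : 'I_r -> 'M[C]_(d2, d1),
    (forall m, K m *m V = W m) /\ psdmx (1%:M - \sum_m (K m) ^t* *m K m).
Proof.
set X := V ^t* *m V => XW0.
have [Z [ZZ XZX ZXZ]] := psdmx_pinv (psdmx_gram V); rewrite -/X in XZX ZXZ.
have congr_gram p (B : 'M[C]_(n, p)) :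
    B ^t* *m (X - \sum_m (W m) ^t* *m W m) *m B =
    B ^t* *m X *m B - \sum_m (W m *m B) ^t* *m (W m *m B).
  rewrite mulmxBr mulmxBl mulmx_sumr mulmx_suml; congr (_ - _).
  by apply: eq_bigr => m _; rewrite adjmx_mul !mulmxA.
have WZX m : W m *m Z *m X = W m.
  (* The columns of [B] lie in the kernel of [X], so compressing the hypothesis by [B] leaves minus
     a sum of Gram matrices; nonnegativity of its diagonal forces each [W m *m B] to vanish. *)
  pose B := Z *m X - 1%:M.
  have XB : X *m B = 0 by rewrite mulmxBr mulmxA XZX mulmx1 subrr.
  suff: W m *m B = 0.
    by rewrite mulmxBr mulmx1 mulmxA => /eqP; rewrite subr_eq0 => /eqP.
  apply: gram_eq0 => j; apply/eqP; rewrite eq_le gram_diag_ge0 andbT.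
  have := psdmx_diag_ge0 j (psdmx_congr B XW0).
  rewrite congr_gram -mulmxA XB mulmx0 sub0r mxE oppr_ge0 summxE.
  apply: le_trans; rewrite (bigD1 m) //= lerDl sumr_ge0 // => k _.
  exact: gram_diag_ge0.
exists (fun m => W m *m Z *m V ^t*); split=> [m|]; first by rewrite -mulmxA WZX.
pose Q := V *m Z *m V ^t*.
have QQ : Q *m Q = Q.
  by rewrite {3}/Q -[in RHS]ZXZ /Q /X !mulmxA.
have PP : (1%:M - Q) ^t* *m (1%:M - Q) = 1%:M - Q.
  rewrite adjmxB adjmx1 !adjmx_mul trmxCK ZZ mulmxA -/Q.
  by rewrite mulmxBl mul1mx mulmxBr mulmx1 QQ subrr subr0.
(* The defect splits as [1%:M - Q], an orthogonal projection, plus [Q] minus the Kraus sum, which is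
   the hypothesis compressed by [Z *m V ^t*]. *)
have -> : 1%:M - \sum_m (W m *m Z *m V ^t*) ^t* *m (W m *m Z *m V ^t*) =
    (1%:M - Q) ^t* *m (1%:M - Q) +
    (Z *m V ^t*) ^t* *m (X - \sum_m (W m) ^t* *m W m) *m (Z *m V ^t*).
  rewrite PP congr_gram adjmx_mul trmxCK ZZ.
  have -> : V *m Z *m X *m (Z *m V ^t*) = Q.
    by rewrite /Q -[in RHS]ZXZ !mulmxA.
  by rewrite addrA subrK; under [in RHS]eq_bigr do rewrite mulmxA.
apply: psdmxD; [exact: psdmx_gram | exact: psdmx_congr].
Qed.

End Positive.

(** * Brackets and rank-one operators *)

Section Kets.
Variable R : realType.
Local Notation C := R[i].

Lemma braket_conj d (u w : 'cV[C]_d) : Num.conj (braket u w) = braket w u.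
Proof.
transitivity (((u ^t* *m w) ^t*) 0 0); first by rewrite /braket ![in RHS]mxE !mxE.
by rewrite adjmx_mul trmxCK.
Qed.

Lemma braketZl d (c : C) (u w : 'cV[C]_d) :
  braket (c *: u) w = Num.conj c * braket u w.
Proof. by rewrite /braket linearZ /= map_mxZ -scalemxAl mxE. Qed.

Lemma braketZr d (c : C) (u w : 'cV[C]_d) : braket u (c *: w) = c * braket u w.
Proof. by rewrite /braket -scalemxAr mxE. Qed.

Lemma braketBr d (u w w' : 'cV[C]_d) :
  braket u (w - w') = braket u w - braket u w'.
Proof. by rewrite /braket mulmxBr !mxE. Qed.

Lemma braket_eq0 d (u : 'cV[C]_d) : braket u u = 0 -> u = 0.
Proof. by move=> uu; apply: gram_eq0 => j; rewrite ord1. Qed.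

Lemma ketbraZ d (c : C) (u : 'cV[C]_d) :
  ketbra (c *: u) (c *: u) = `|c| ^+ 2 *: ketbra u u.
Proof.
by rewrite /ketbra linearZ /= map_mxZ -scalemxAl -scalemxAr scalerA normCK.
Qed.

Lemma mulmx_ketbra d1 d2 (K : 'M[C]_(d2, d1)) (u : 'cV[C]_d1) :
  K *m ketbra u u *m K ^t* = ketbra (K *m u) (K *m u).
Proof. by rewrite /ketbra adjmx_mul !mulmxA. Qed.

Lemma expectation_ketbra d (u w : 'cV[C]_d) :
  (w ^t* *m ketbra u u *m w) 0 0 = `|braket w u| ^+ 2.
Proof.
rewrite /ketbra !mulmxA -mulmxA mxE big_ord1 normCK.
by congr (_ * _); rewrite braket_conj.
Qed.

Lemma mxtrace_ketbra d (u : 'cV[C]_d) : \tr (ketbra u u) = braket u u.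
Proof. by rewrite /ketbra mxtrace_mulC [\tr _]big_ord1. Qed.

Lemma gram_entry d m n (A : 'M[C]_(d, m)) (B : 'M[C]_(d, n)) s r :
  (A ^t* *m B) s r = braket (col s A) (col r B).
Proof. by rewrite /braket !mxE; apply: eq_bigr => k _; rewrite !mxE. Qed.

(** Taking expectations in [w] gives [\sum_m |<w|x_m>|^2 = e |<w|psi>|^2]. The choice [w = psi]
    yields the weights. If [w] is the component of [x m] orthogonal to [psi], the right side is
    zero, so [<w|x_m> = 0]; this is the squared norm of [w]. *)
Lemma sum_ketbra_pure d r (x : 'I_r -> 'cV[C]_d) (psi : 'cV[C]_d) (e : C) :
  unit_ket psi -> \sum_m ketbra (x m) (x m) = e *: ketbra psi psi ->
  (forall m, x m = braket psi (x m) *: psi) /\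
  \sum_m `|braket psi (x m)| ^+ 2 = e.
Proof.
move=> psi1 xE.
have sum_braket w : \sum_m `|braket w (x m)| ^+ 2 = e * `|braket w psi| ^+ 2.
  rewrite -expectation_ketbra.
  have -> : e * (w ^t* *m ketbra psi psi *m w) 0 0 =
            (w ^t* *m (e *: ketbra psi psi) *m w) 0 0.
    by rewrite -scalemxAr -scalemxAl [RHS]mxE.
  rewrite -xE mulmx_sumr mulmx_suml summxE.
  by apply: eq_bigr => m _; rewrite expectation_ketbra.
split=> [m|]; last by rewrite sum_braket psi1 normr1 expr1n mulr1.
apply/eqP; rewrite -subr_eq0; apply/eqP/braket_eq0.
set w := x m - _.
have w_psi : braket w psi = 0.
  by rewrite -braket_conj braketBr braketZr psi1 mulr1 subrr conjC0.
have /psumr_eq0P-/(_ (fun i _ => exprn_ge0 2 (normr_ge0 _)))/(_ m isT)/eqP :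
    \sum_m `|braket w (x m)| ^+ 2 = 0.
  by rewrite sum_braket w_psi normr0 expr0n mulr0.
rewrite expf_eq0 normr_eq0 => /eqP w_x.
by rewrite {2}/w braketBr braketZr w_x w_psi mulr0 subr0.
Qed.

(** * Kraus operators versus the matrix inequality, over a single index *)

Section Transformation.
Variables (d1 d2 N : nat).
Variables (u : 'I_N -> 'cV[C]_d1) (psi : 'I_N -> 'cV[C]_d2) (e : 'I_N -> C).
Hypothesis psi_unit : forall s, unit_ket (psi s).
Hypothesis e_ge0 : forall s, 0 <= e s.

Let g s := sqrtC (e s).
Let V := \matrix_(a, s) u s a 0.

Let g_conj s : Num.conj (g s) = g s.
Proof. by rewrite geC0_conj // sqrtC_ge0. Qed.

Let colV s : col s V = u s.
Proof. by apply/colP=> a; rewrite !mxE. Qed.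

Let col_mulV d (K : 'M[C]_(d, d1)) s : col s (K *m V) = K *m u s.
Proof. by rewrite colE -mulmxA -colE colV. Qed.

(** Entrywise form of the matrix whose positivity the theorem asserts, free of blocks. *)
Definition gram_difference (A : 'M[C]_N) : 'M[C]_N :=
  \matrix_(s, r) (braket (u s) (u r) -
    sqrtC (e s) * braket (psi s) (psi r) * sqrtC (e r) * A s r).

Lemma kraus_gram r (K : 'I_r -> 'M[C]_(d2, d1)) :
  psdmx (1%:M - \sum_m (K m) ^t* *m K m) ->
  (forall s, \sum_m K m *m ketbra (u s) (u s) *m (K m) ^t* =
             e s *: ketbra (psi s) (psi s)) ->
  exists A : 'M[C]_N,
    [/\ psdmx A, forall s, A s s = 1 & psdmx (gram_difference A)].
Proof.
move=> K0 Ku.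
pose c m s := braket (psi s) (K m *m u s).
have cP s : (forall m, K m *m u s = c m s *: psi s) /\
            \sum_m `|c m s| ^+ 2 = e s.
  by apply: sum_ketbra_pure => //; under eq_bigr do rewrite -mulmx_ketbra.
pose a := \matrix_(m < r, s < N) (c m s / g s).
have g_eq0 s : (g s == 0) = (e s == 0) by rewrite sqrtC_eq0.
(* This survives the division by zero in [a]: if [e s = 0], the squared moduli of the [c m s] sum to
   zero, so both sides vanish. *)
have ca m s : c m s = g s * a m s.
  rewrite mxE mulrCA; have [/eqP|g_neq0] := eqVneq (g s) 0; last first.
    by rewrite divff ?mulr1.
  rewrite g_eq0 => /eqP e0; rewrite /g e0 sqrtC0 mul0r mulr0; apply/eqP.
  have [_] := cP s; rewrite e0.
  move=> /psumr_eq0P-/(_ (fun i _ => exprn_ge0 2 (normr_ge0 _)))/(_ m isT)/eqP.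
  by rewrite expf_eq0 normr_eq0.
(* Where e vanishes, the normalised coefficients are junk zeros; the
   indicator D restores the unit diagonal there. *)
pose dn := \row_s (e s == 0)%:R : 'rV[C]_N.
pose D := diag_mx dn.
have DD : D = D ^t* *m D.
  rewrite tr_diag_mx map_diag_mx mulmx_diag; congr diag_mx.
  by apply/rowP=> s; rewrite !mxE /= conjC_nat -natrM mulnb andbb.
have psdD : psdmx D by rewrite DD; apply: psdmx_gram.
exists (a ^t* *m a + D); split.
- by apply: psdmxD => //; apply: psdmx_gram.
- move=> s; rewrite mxE gram_diag !mxE eqxx mulr1n.
  have [e0|e_neq0] := eqVneq (e s) 0.
    rewrite big1 ?add0r // => m _.
    by rewrite mxE /g e0 sqrtC0 invr0 mulr0 normr0 expr0n.
  rewrite addr0; apply: (mulfI e_neq0); rewrite mulr1.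
  rewrite -[RHS](cP s).2 mulr_sumr; apply: eq_bigr => m _.
  by rewrite ca normrM exprMn [in RHS]ger0_norm ?sqrtC_ge0 // sqrtCK.
- suff -> : gram_difference (a ^t* *m a + D) =
      V ^t* *m (1%:M - \sum_m (K m) ^t* *m K m) *m V by apply: psdmx_congr.
  apply/matrixP=> s s'; rewrite mulmxBr mulmx1 mulmxBl mulmx_sumr mulmx_suml.
  rewrite mxE [RHS]mxE gram_entry !colV; congr (_ + _).
  rewrite [RHS]mxE summxE; congr (- _).
  rewrite [(_ + D) s s']mxE.
  have -> : D s s' = (e s == 0)%:R *+ (s == s') by rewrite !mxE.
  (* The correction [D] is invisible here: it is nonzero only where the factor [sqrtC (e s)] is
     zero. *)
  have -> : sqrtC (e s) * braket (psi s) (psi s') * sqrtC (e s') *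
      ((a ^t* *m a) s s' + (e s == 0)%:R *+ (s == s')) =
      g s * braket (psi s) (psi s') * g s' * (a ^t* *m a) s s'.
    have [e0|_] := eqVneq (e s) 0; first by rewrite /g e0 sqrtC0 !mul0r.
    by rewrite mul0rn addr0.
  rewrite mxE mulr_sumr; apply: eq_bigr => m _.
  rewrite mulmxA -adjmx_mul -mulmxA gram_entry !col_mulV.
  rewrite (cP s).1 (cP s').1 braketZl braketZr !ca rmorphM /= g_conj !mxE.
  ring.
Qed.

Lemma gram_kraus (A : 'M[C]_N) :
  psdmx A -> (forall s, A s s = 1) -> psdmx (gram_difference A) ->
  exists (r : nat) (K : 'I_r -> 'M[C]_(d2, d1)),
    psdmx (1%:M - \sum_m (K m) ^t* *m K m) /\
    forall s, \sum_m K m *m ketbra (u s) (u s) *m (K m) ^t* =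
              e s *: ketbra (psi s) (psi s).
Proof.
move=> /psdmx_factor[a AE] A1 GA.
(* Each row of [a] supplies the coefficients of one Kraus operator, hence [N] operators in all. *)
pose W m := \matrix_(b < d2, s < N) (g s * a m s * psi s b 0).
have colW m s : col s (W m) = (g s * a m s) *: psi s.
  by apply/colP=> b; rewrite !mxE.
have /kraus_factor[K [KV K1]] :
    psdmx (V ^t* *m V - \sum_m (W m) ^t* *m W m).
  suff <- : gram_difference A = V ^t* *m V - \sum_m (W m) ^t* *m W m by [].
  apply/matrixP=> s s'; rewrite mxE [RHS]mxE gram_entry !colV; congr (_ + _).
  rewrite [RHS]mxE summxE AE mxE mulr_sumr; congr (- _).
  apply: eq_bigr => m _; rewrite gram_entry !colW braketZl braketZr.
  by rewrite rmorphM /= g_conj !mxE /= /g; ring.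
exists N, K; split=> // s.
have Ku m : K m *m u s = (g s * a m s) *: psi s by rewrite -col_mulV KV colW.
under eq_bigr do rewrite mulmx_ketbra Ku ketbraZ.
rewrite -scaler_suml; congr (_ *: _).
(* The unit diagonal of [A] says that the columns of [a] have norm one, so the weights add up to
   [e s]. *)
rewrite -[RHS]mulr1 -(A1 s) AE gram_diag mulr_sumr.
apply: eq_bigr => m _.
by rewrite normrM exprMn [in LHS]ger0_norm ?sqrtC_ge0 // sqrtCK.
Qed.

End Transformation.
End Kets.


(** * From the single index back to block matrices *)

Section Blocks.
Variables (R : realType) (d1 d2 n : nat) (t : 'I_n -> nat).
Variables (v : forall i : 'I_n, 'I_(t i) -> 'cV[R[i]]_d1).
Variables (phi : 'I_n -> 'cV[R[i]]_d2) (eta : forall i : 'I_n, 'I_(t i) -> R).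

(** The type of [tagnat.sig2 s] depends on [tagnat.sig1 s], so both are rewritten at once through
    the tagged pair. *)
Lemma forall_tagnat (P : forall i, 'I_(t i) -> Prop) :
  (forall s : 'I_(\sum_i t i), P (tagnat.sig1 s) (tagnat.sig2 s)) ->
  forall i k, P i k.
Proof.
move=> Ps i k; have := Ps (tagnat.rank (Tagged (fun j => 'I_(t j)) k)).
by rewrite /tagnat.sig2 /tagnat.sig1 tagnat.rankK.
Qed.

Lemma Gamma_diag : Gamma eta =
  diag_mx (\row_s (eta (tagnat.sig2 s))%:C).
Proof.
(* [\mxdiag] casts its blocks by [conform_mx]; destructing [i = j] removes the cast and leaves an
   ordinary diagonal matrix. *)
have block0 i j (k : 'I_(t i)) (l : 'I_(t j)) : i = j ->
    tagnat.Rank i k != tagnat.Rank j l ->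
    conform_mx (0 : 'M_(t i, t j)) (Gamma_block eta i) k l = 0.
  move=> ij; case: j / ij l => l kl; rewrite conform_mx_id !mxE.
  by case: (eqVneq k l) kl => [->|//]; rewrite eqxx.
apply/matrixP=> s r; rewrite !mxE.
have [<-|sr] := eqVneq s r; first by rewrite eqxx conform_mx_id !mxE eqxx.
by case: eqP => [e1|_]; rewrite ?mxE ?block0 ?tagnat.sig2K.
Qed.

(** Since [sqrtC 0 = 0], the entrywise root of [Gamma] is again diagonal, and its two factors scale
    rows and columns. Nonnegativity of [eta] makes the roots real, so conjugation fixes them. *)
Lemma block_gram_difference (A : 'M[R[i]]_(\sum_(i < n) t i)) :
  (forall (i : 'I_n) (k : 'I_(t i)), 0 <= eta k) ->
  Xtilde v -
    hadamard (sqrt_mx (Gamma eta) *m Ymx t phi *m (sqrt_mx (Gamma eta)) ^t*) A =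
  gram_difference (fun s => v (tagnat.sig2 s)) (fun s => phi (tagnat.sig1 s))
    (fun s => (eta (tagnat.sig2 s))%:C) A.
Proof.
move=> eta_ge0.
have -> : sqrt_mx (Gamma eta) =
    diag_mx (\row_s sqrtC ((eta (tagnat.sig2 s))%:C : R[i])).
  rewrite Gamma_diag; apply/matrixP=> s r; rewrite !mxE.
  by case: eqP => // _; rewrite !mulr0n sqrtC0.
rewrite tr_diag_mx map_diag_mx mul_mx_diag mul_diag_mx.
apply/matrixP=> s r; rewrite !mxE; congr (_ - _ * _ * _) => /=.
by rewrite geC0_conj // sqrtC_ge0 ler0c.
Qed.

End Blocks.

Theorem lemma3 (R : realType) (d1 d2 n : nat)
    (rho : 'I_n -> 'M[R[i]]_d1) (phi : 'I_n -> 'cV[R[i]]_d2)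
    (t : 'I_n -> nat) (v : forall i : 'I_n, 'I_(t i) -> 'cV[R[i]]_d1)
    (eta : forall i : 'I_n, 'I_(t i) -> R)
    (rho_density : forall i, density_operator (rho i))
    (phi_unit : forall i, unit_ket (phi i))
    (rho_spectral : forall i, spectral_decomposition (rho i) (v i))
    (eta_ge0 : forall (i : 'I_n) (k : 'I_(t i)), 0 <= eta i k) :
  (transformable v phi eta <->
   exists A : 'M[R[i]]_(\sum_(i < n) t i),
     [/\ psdmx A,
         forall (i : 'I_n) (k : 'I_(t i)), submxblock A i i k k = 1
       & psdmx (Xtilde v -
           hadamard (sqrt_mx (Gamma eta) *m Ymx t phi *m (sqrt_mx (Gamma eta)) ^t*) A)])
  /\
  (forall xi : 'M[R[i]]_d1 -> 'M[R[i]]_d2, transforms v phi eta xi ->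
   forall p : 'I_n -> R, (forall i, 0 <= p i) -> \sum_(i < n) p i = 1 ->
   whole_success_probability p rho xi =
     \sum_(i < n) (p i)%:C * \tr (Gamma_block eta i)).
Proof.
pose u s := v (tagnat.sig1 s) (tagnat.sig2 s).
pose psi (s : 'I_(\sum_(i < n) t i)) := phi (tagnat.sig1 s).
pose e s : R[i] := (eta (tagnat.sig1 s) (tagnat.sig2 s))%:C.
have e_ge0 s : 0 <= e s by rewrite ler0c.
have psi_unit s : unit_ket (psi s) by exact: phi_unit.
split; first split.
- move=> [xi [[r [K [xiE K1]]] xi_v]].
  have [s|A [A0 A1 GA]] := kraus_gram psi_unit e_ge0 (u := u) K1.
    by rewrite -xiE xi_v.
  exists A; split=> // [i k|]; first by rewrite mxE A1.
  by rewrite block_gram_difference.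
- move=> [A [A0 A1 GA]]; rewrite block_gram_difference // in GA.
  have A1' s : A s s = 1.
    by have := A1 (tagnat.sig1 s) (tagnat.sig2 s); rewrite mxE tagnat.sig2K.
  have [r [K [K1 Ku]]] := gram_kraus e_ge0 A0 A1' GA.
  exists (fun M => \sum_m K m *m M *m (K m) ^t*); split; first by exists r, K.
  exact: forall_tagnat.
- move=> xi [[r [K [xiE _]]] xi_v] p _ _.
  apply: eq_bigr => i _; congr (_ * _); rewrite /success_probability.
  have [-> _ _] := rho_spectral i.
  (* [xi] is a bare function; its additivity comes from the Kraus form. *)
  have -> : xi (\sum_k ketbra (v i k) (v i k)) =
      \sum_k xi (ketbra (v i k) (v i k)).
    rewrite xiE; under [RHS]eq_bigr do rewrite xiE.
    rewrite exchange_big /=; apply: eq_bigr => m _.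
    by rewrite mulmx_sumr mulmx_suml.
  rewrite raddf_sum mxtrace_diag; apply: eq_bigr => k _.
  by rewrite xi_v /= mxtraceZ mxtrace_ketbra phi_unit mulr1 mxE.
Qed.
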